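(* Let $G$ be an unweighted directed graph with $m$ directed edges, and assume every vertex has indegree at least $d\ge 0$. Fix $v\in V(G)$ with $\operatorname{ept}_{\mathrm{rzf}}(G,v)<\infty$. Then $$\operatorname{ept}_{\mathrm{rzf}}(G,v)\le m-d.$$
   Context: Directed graphs are finite, without loops or multiple edges (edges in both directions between two vertices are allowed). Randomized zero forcing (RZF) on an unweighted directed graph $G$: start with blue set $B_0$. Given the blue set $B_t$, each white vertex $w\notin B_t$ independently becomes blue at round $t+1$ with probability equal to (number of in-neighbors of $w$ in $B_t$)/(indegree of $w$), and with probability $0$ if $w$ has indegree $0$; blue vertices stay blue forever. $\operatorname{ept}_{\mathrm{rzf}}(G,v)$ is the expected value of $\tau=\min\{t: B_t=V(G)\}$ started from $B_0=\{v\}$ if it is possible to color all of $G$ blue from $\{v\}$, and $\infty$ otherwise. *)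

(* Defs.v *)
(* A directed graph without multiple edges on the finite vertex set V is a
   relation e : rel V, where e u w means that there is an edge from u to w;
   "no loops" is irreflexive e. *)
From HB Require Import structures.
From mathcomp Require Import all_boot all_order all_algebra.
From mathcomp Require Import boolp reals ereal topology normedtype sequences.

Set Implicit Arguments.
Unset Strict Implicit.
Unset Printing Implicit Defensive.

Import Order.TTheory GRing.Theory Num.Theory.

Local Open Scope ring_scope.

Section RandomizedZeroForcing.
Variables (R : realType) (V : finType) (e : rel V).

Definition num_edges : nat := #|[set p : V * V | e p.1 p.2]|.

Definition indegree (w : V) : nat := #|[set u | e u w]|.

(* When w has indegree 0 this is 0 / 0, which is 0 in MathComp. *)
Definition rzf_vertex_prob (B : {set V}) (w : V) : R :=
  #|[set u in B | e u w]|%:R / (indegree w)%:R.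

(* P(B_{t+1} = B' | B_t = B): blue vertices stay blue and the white ones are
   colored independently. *)
Definition rzf_step (B B' : {set V}) : R :=
  if B \subset B' then
    \prod_(w | w \notin B)
      (if w \in B' then rzf_vertex_prob B w else 1 - rzf_vertex_prob B w)
  else 0.

Lemma rzf_vertex_prob_ge0 (B : {set V}) (w : V) : 0 <= rzf_vertex_prob B w.
Proof. by rewrite /rzf_vertex_prob divr_ge0 ?ler0n. Qed.

Lemma rzf_vertex_prob_le1 (B : {set V}) (w : V) : rzf_vertex_prob B w <= 1.
Proof.
rewrite /rzf_vertex_prob; have [->|] := posnP (indegree w).
  by rewrite invr0 mulr0.
move=> d0; rewrite ler_pdivrMr ?ltr0n// mul1r ler_nat.
by apply/subset_leq_card/subsetP => u; rewrite !inE => /andP[].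
Qed.

Lemma rzf_step_ge0 (B B' : {set V}) : 0 <= rzf_step B B'.
Proof.
rewrite /rzf_step; case: ifP => // _; apply: prodr_ge0 => w _.
by case: ifP; rewrite ?subr_ge0 ?rzf_vertex_prob_le1 ?rzf_vertex_prob_ge0.
Qed.

Lemma rzf_step_sum1 (B : {set V}) : \sum_(B' : {set V}) rzf_step B B' = 1.
Proof.
pose F (w : V) (b : bool) : R :=
  if w \in B then b%:R
  else if b then rzf_vertex_prob B w else 1 - rzf_vertex_prob B w.
have stepE (B' : {set V}) : rzf_step B B' = \prod_w F w (w \in B').
  rewrite [RHS](bigID (mem B)) /rzf_step /=; case: ifPn => [sB|/subsetPn[w wB wB']].
    rewrite [X in X * _]big1 ?mul1r; last by move=> w wB; rewrite /F wB (subsetP sB).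
    by apply: eq_bigr => w /negbTE wB; rewrite /F wB.
  by rewrite (bigD1 w)//= /F wB (negbTE wB') !mul0r.
rewrite (eq_bigr _ (fun B' _ => stepE B')).
rewrite (reindex (fun f : {ffun V -> bool} => [set w | f w])) /=; last first.
  exists (fun B' : {set V} => [ffun w => w \in B']) => [f _|B' _].
    by apply/ffunP => w; rewrite ffunE inE.
  by apply/setP => w; rewrite inE ffunE.
under eq_bigr => f _ do under eq_bigr => w _ do rewrite inE.
rewrite -(bigA_distr_bigA F) big1// => w _.
rewrite big_bool /F /=; case: ifP => _; first by rewrite addr0.
by rewrite addrC subrK.
Qed.

(* P(B_0 = h 0, ..., B_t = h t) for the process started from B0. *)
Definition rzf_traj_prob (B0 : {set V}) (t : nat)
    (h : {ffun 'I_t.+1 -> {set V}}) : R :=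
  (h ord0 == B0)%:R * \prod_(i < t) rzf_step (h (inord i)) (h (inord i.+1)).

(* P(tau = t), where tau = min {t | B_t = V}. *)
Definition rzf_tau_prob (B0 : {set V}) (t : nat) : R :=
  \sum_(h : {ffun 'I_t.+1 -> {set V}} |
      (h ord_max == [set: V]) && [forall i : 'I_t, h (inord i) != [set: V]])
    rzf_traj_prob B0 h.

Definition rzf_can_color (B0 : {set V}) : bool :=
  connect (fun B B' => 0 < rzf_step B B') B0 [set: V].

(* If V is reachable from [set v], it is reachable from every later blue set,
   so the finite absorbing chain has tau < oo almost surely and
   E[tau] = \sum_t t * P(tau = t). *)
Definition ept_rzf (v : V) : \bar R :=
  if rzf_can_color [set v] then
    (\sum_(0 <= t <oo) (t%:R * rzf_tau_prob [set v] t)%:E)%E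
  else +oo%E.

End RandomizedZeroForcing.

(* Main.v *)
(* The potential Phi(B), the sum of the indegrees of the white vertices,
   decreases in expectation during one round by
   \sum_(w white) deg(w) * (a_w / deg(w)) = \sum_(w white) a_w, the number of
   edges from blue to white vertices (a_w is the number of blue in-neighbors
   of w).  This is at least 1 as long as B <> V, since V can be reached from
   v.  Hence E[tau] <= Phi({v}) = m - deg(v) <= m - d. *)
Require Import Defs.
From mathcomp Require Import all_boot all_order all_algebra.
From mathcomp Require Import reals ereal topology normedtype sequences.

Import Order.TTheory GRing.Theory Num.Theory.

Section ExpectedPropagationTime.
Local Open Scope ring_scope.
Variables (R : realType) (V : finType) (e : rel V).
Implicit Types (B C : {set V}) (u v w : V).

(** * One round as a product of independent vertex colorings *)

Lemma sum_set_prod (F : V -> bool -> R) :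
  \sum_(B : {set V}) \prod_w F w (w \in B) = \prod_w (F w true + F w false).
Proof.
rewrite (reindex (fun f : {ffun V -> bool} => [set w | f w])) /=; last first.
  exists (fun B : {set V} => [ffun w => w \in B]) => [f _|B _].
    by apply/ffunP => w; rewrite ffunE inE.
  by apply/setP => w; rewrite inE ffunE.
under eq_bigr => f _ do under eq_bigr => w _ do rewrite inE.
by rewrite -(bigA_distr_bigA F); apply: eq_bigr => w _; rewrite big_bool.
Qed.

(** Blue vertices get a 0/1 factor, so one product over all of [V] also encodes the test
    [B \subset C] of [rzf_step]. *)
Definition color_prob B w (b : bool) : R :=
  if w \in B then b%:R
  else if b then rzf_vertex_prob R e B w else 1 - rzf_vertex_prob R e B w.

Lemma color_prob_sum1 B w : color_prob B w true + color_prob B w false = 1.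
Proof.
by rewrite /color_prob; case: ifP => _; rewrite ?addr0 // addrC subrK.
Qed.

Lemma rzf_step_prodE B C : rzf_step R e B C = \prod_w color_prob B w (w \in C).
Proof.
rewrite [RHS](bigID (mem B)) /rzf_step /=.
case: ifPn => [sB|/subsetPn[w wB wC]].
  rewrite [X in X * _]big1 ?mul1r; last first.
    by move=> w wB; rewrite /color_prob wB (subsetP sB).
  by apply: eq_bigr => w /negbTE wB; rewrite /color_prob wB.
by rewrite (bigD1 w)//= /color_prob wB (negbTE wC) !mul0r.
Qed.

(** The indicator only alters the factor at [w]; by independence every other factor sums to 1. *)
Lemma rzf_step_marginal B w :
  \sum_C rzf_step R e B C * (w \notin C)%:R = color_prob B w false.
Proof.
pose F u b : R := color_prob B u b * (if u == w then (~~ b)%:R else 1).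
have FE C : rzf_step R e B C * (w \notin C)%:R = \prod_u F u (u \in C).
  by rewrite big_split -rzf_step_prodE /= -big_mkcond big_pred1_eq.
rewrite (eq_bigr _ (fun C _ => FE C)) sum_set_prod (bigD1 w) //= /F eqxx.
rewrite mulr0 add0r mulr1 big1 ?mulr1 // => u /negbTE->.
by rewrite !mulr1 color_prob_sum1.
Qed.

(** * The potential and its drift *)

Definition potential B : R := \sum_(w | w \notin B) (indegree e w)%:R.

Lemma potential_ge0 B : 0 <= potential B.
Proof. by apply: sumr_ge0 => w _; apply: ler0n. Qed.

Lemma indegree_mul_vertex_prob B w :
  (indegree e w)%:R * rzf_vertex_prob R e B w = #|[set u in B | e u w]|%:R.
Proof.
rewrite /rzf_vertex_prob; have [d0|d0] := posnP (indegree e w); last first.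
  by rewrite mulrC divfK // pnatr_eq0 -lt0n.
(* With indegree 0 the left side vanishes, and [w] has no blue in-neighbor either. *)
rewrite d0 mul0r; apply/esym/eqP; rewrite pnatr_eq0 -leqn0 -d0.
by apply/subset_leq_card/subsetP => u; rewrite !inE => /andP[].
Qed.

(** Linearity of expectation: [w] contributes its indegree times the probability that it stays
    white. *)
Lemma sum_step_potential B :
  \sum_C rzf_step R e B C * potential C =
  potential B - \sum_(w | w \notin B) #|[set u in B | e u w]|%:R.
Proof.
transitivity (\sum_w (indegree e w)%:R * color_prob B w false); last first.
  rewrite /potential -sumrB [RHS]big_mkcond; apply: eq_bigr => w _ /=.
  rewrite /color_prob; case: (w \in B) => /=; first by rewrite mulr0.
  by rewrite mulrBr mulr1 indegree_mul_vertex_prob.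
under [LHS]eq_bigr => C _ do
  rewrite /potential (big_mkcond (fun w => w \notin C)) mulr_sumr.
rewrite exchange_big; apply: eq_bigr => w _.
rewrite -rzf_step_marginal mulr_sumr; apply: eq_bigr => C _ /=.
by case: (w \notin C); rewrite ?mulr0 // mulr1 mulrC.
Qed.

(** If no edge left [C], the blue set could never grow out of [C], hence could not reach
    [[set: V]]. *)
Lemma can_color_boundary B C : rzf_can_color R e B -> B \subset C ->
  C != [set: V] -> exists2 w, w \notin C & exists2 u, u \in C & e u w.
Proof.
move=> /connectP[p pB lastp] sBC CT.
have [/existsP[w /andP[wC /existsP[u /andP[uC euw]]]]|no_edge] :=
  boolP [exists w, (w \notin C) && [exists u, (u \in C) && e u w]].
  by exists w => //; exists u.
case/negP: CT; rewrite -subTset lastp.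
(* Invariant along the path: every blue set lies in [C]. A new vertex outside [C] would make the
   step probability 0. *)
elim: p B sBC pB {lastp} => //= D p IH B sBC /andP[stepBD]; apply: IH.
apply/subsetP => w wD; apply: contraT => wC.
have wB : w \notin B by apply: contra wC => /(subsetP sBC).
suff p0 : rzf_vertex_prob R e B w = 0.
  move: stepBD; rewrite rzf_step_prodE (bigD1 w) //= /color_prob (negbTE wB) wD.
  by rewrite p0 mul0r ltxx.
rewrite /rzf_vertex_prob; suff -> : [set u in B | e u w] = set0.
  by rewrite cards0 mul0r.
apply/setP => u; rewrite !inE; apply/negP => /andP[uB euw].
case/negP: no_edge; apply/existsP; exists w; rewrite wC /=.
by apply/existsP; exists u; rewrite euw (subsetP sBC).
Qed.

Lemma potential_drift v B : rzf_can_color R e [set v] -> v \in B ->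
  B != [set: V] -> \sum_C rzf_step R e B C * potential C <= potential B - 1.
Proof.
move=> colv vB BT; rewrite sum_step_potential lerD2l lerN2.
have [|w wB [u uB euw]] := can_color_boundary _ B colv _ BT.
  by rewrite sub1set.
rewrite (bigD1 w) //= -[X in X <= _]addr0 lerD ?sumr_ge0 //.
by rewrite ler1n; apply/card_gt0P; exists u; rewrite inE uB.
Qed.

(** * First-step decomposition of trajectories and of the law of tau *)

Definition traj_cons t (B : {set V}) (g : {ffun 'I_t -> {set V}}) :
    {ffun 'I_t.+1 -> {set V}} :=
  [ffun i => oapp g B (unlift ord0 i)].

Lemma traj_cons0 t B (g : {ffun 'I_t -> {set V}}) : traj_cons t B g ord0 = B.
Proof. by rewrite ffunE unlift_none. Qed.

Lemma traj_cons_lift t B (g : {ffun 'I_t -> {set V}}) i :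
  traj_cons t B g (lift ord0 i) = g i.
Proof. by rewrite ffunE liftK. Qed.

Lemma traj_cons_inord t B (g : {ffun 'I_t.+1 -> {set V}}) k : (k <= t)%N ->
  traj_cons t.+1 B g (inord k.+1) = g (inord k).
Proof.
move=> kt; rewrite -(traj_cons_lift _ B g (inord k)); congr (traj_cons _ _ _ _).
by apply: val_inj; rewrite /= /bump /= !inordK.
Qed.

Lemma sum_traj_cons t (F : {ffun 'I_t.+1 -> {set V}} -> R) :
  \sum_h F h = \sum_B \sum_g F (traj_cons t B g).
Proof.
rewrite pair_big (reindex (fun p => traj_cons t p.1 p.2)) //=.
exists (fun h => (h ord0, [ffun i => h (lift ord0 i)])) => [[B g] _|h _] /=.
  by rewrite traj_cons0; congr (_, _); apply/ffunP => i;
    rewrite ffunE traj_cons_lift.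
by apply/ffunP => i; rewrite ffunE; case: unliftP => [j|] -> //=; rewrite ffunE.
Qed.

Lemma inord0 t : inord 0 = ord0 :> 'I_t.+1.
Proof. by apply: val_inj; rewrite /= inordK. Qed.

Lemma rzf_tau_prob0 B : rzf_tau_prob R e B 0 = (B == [set: V])%:R.
Proof.
rewrite /rzf_tau_prob big_mkcond sum_traj_cons (bigD1 B) //=.
rewrite [X in _ + X]big1 ?addr0.
  (* The tail is empty: [g0] is the only function on ['I_0]. *)
  pose g0 : {ffun 'I_0 -> {set V}} := [ffun=> B].
  rewrite (big_pred1 g0); last first.
    by move=> g; apply/esym/eqP/ffunP; case.
  rewrite (_ : ord_max = ord0); last exact: val_inj.
  rewrite /rzf_traj_prob traj_cons0 big_ord0 eqxx.
  case: (B == _) => //=.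
  by case: forallP => [_|[]]; [rewrite mulr1 | case].
move=> C CB; apply: big1 => g _.
by rewrite /rzf_traj_prob traj_cons0 (negbTE CB) mul0r if_same.
Qed.

(** Starting the tail at its own first state [g ord0] makes its initial indicator 1, so only its
    step factors remain. *)
Lemma rzf_traj_probS t B C (g : {ffun 'I_t.+1 -> {set V}}) :
  rzf_traj_prob R e B (traj_cons t.+1 C g) =
  (C == B)%:R * (rzf_step R e C (g ord0) * rzf_traj_prob R e (g ord0) g).
Proof.
rewrite /rzf_traj_prob traj_cons0 eqxx mul1r big_ord_recl /=.
rewrite inord0 traj_cons0 traj_cons_inord // inord0.
congr (_ * (_ * _)); apply: eq_bigr => i _.
by rewrite /bump /= !add1n !traj_cons_inord // ltnW.
Qed.

Lemma traj_cons_hits_last t B (g : {ffun 'I_t.+1 -> {set V}}) (T : {set V}) :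
  (traj_cons t.+1 B g ord_max == T) &&
    [forall i : 'I_t.+1, traj_cons t.+1 B g (inord i) != T] =
  (B != T) &&
    ((g ord_max == T) && [forall i : 'I_t, g (inord i) != T]).
Proof.
have -> : ord_max = lift ord0 ord_max :> 'I_t.+2 by apply: val_inj.
rewrite traj_cons_lift andbCA; congr andb; apply/forallP/andP => [allT|].
  split; first by have := allT ord0; rewrite inord0 traj_cons0.
  apply/forallP => i; have := allT (lift ord0 i).
  by rewrite /= /bump add1n traj_cons_inord // ltnW.
move=> [BT /forallP allT] i; case: (unliftP ord0 i) => [j ->|->].
  by rewrite /= /bump add1n traj_cons_inord // ltnW.
by rewrite inord0 traj_cons0.
Qed.

(** Markov property: condition on the blue set after one round. The first factor excludes tau =
    0. *)
Lemma rzf_tau_probS t B : rzf_tau_prob R e B t.+1 =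
  (B != [set: V])%:R * \sum_C rzf_step R e B C * rzf_tau_prob R e C t.
Proof.
rewrite {1}/rzf_tau_prob big_mkcond sum_traj_cons (bigD1 B) //=.
rewrite [X in _ + X]big1.
  rewrite addr0 /rzf_tau_prob.
  under [in RHS]eq_bigr => C _ do rewrite mulr_sumr.
  rewrite exchange_big mulr_sumr [RHS]big_mkcond; apply: eq_bigr => g _ /=.
  rewrite traj_cons_hits_last rzf_traj_probS eqxx mul1r.
  (* For a fixed tail [g], only the next state [C = g ord0] contributes. *)
  rewrite [in RHS](bigD1 (g ord0)) //= [X in _ + X]big1 ?addr0.
    by case: (B != _) => /=; rewrite ?mul0r ?mul1r // if_same.
  by move=> C CB; rewrite /rzf_traj_prob eq_sym (negbTE CB) mul0r mulr0.
move=> C /negbTE CB; apply: big1 => g _.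
by rewrite rzf_traj_probS CB mul0r if_same.
Qed.

(** * From drift to a bound on the expectation *)

Lemma rzf_tau_prob_ge0 B t : 0 <= rzf_tau_prob R e B t.
Proof.
apply: sumr_ge0 => h _; rewrite mulr_ge0 ?ler0n // prodr_ge0 // => i _.
exact: rzf_step_ge0.
Qed.

Lemma sum_rzf_tau_prob_le1 B n : \sum_(t < n) rzf_tau_prob R e B t <= 1.
Proof.
elim: n B => [|n IH] B; first by rewrite big_ord0.
rewrite big_ord_recl /= rzf_tau_prob0.
under eq_bigr => t _ do rewrite /bump add1n rzf_tau_probS.
rewrite -mulr_sumr; case: (B == _) => /=; first by rewrite mul0r addr0.
rewrite add0r mul1r exchange_big /= -(rzf_step_sum1 R e B); apply: ler_sum => C _.
by rewrite -mulr_sumr ler_piMr ?rzf_step_ge0.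
Qed.

(** Induction on the truncation [n], for all [B] containing [v]. After one round t + 1 splits into
    t, bounded by the potential of the new set, and 1, bounded by total mass at most 1; the drift of
    -1 pays for the latter. *)
Lemma sum_rzf_tau_le_potential v B n : rzf_can_color R e [set v] -> v \in B ->
  \sum_(t < n) t%:R * rzf_tau_prob R e B t <= potential B.
Proof.
move=> colv; elim: n B => [|n IH] B vB; first by rewrite big_ord0 potential_ge0.
rewrite big_ord_recl /= mul0r add0r.
under eq_bigr => t _ do rewrite /bump add1n rzf_tau_probS.
have [_|BT] := eqVneq B; rewrite /=.
  by rewrite big1 ?potential_ge0 // => t _; rewrite mul0r mulr0.
under eq_bigr => t _ do rewrite mul1r mulr_sumr.
rewrite exchange_big /= -(subrK 1 (potential B)).
apply: le_trans (lerD (potential_drift _ _ colv vB BT) (lexx _)).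
rewrite -[X in _ <= _ + X](rzf_step_sum1 R e B) -big_split /=.
apply: ler_sum => C _.
under eq_bigr => t _ do rewrite mulrCA.
(* The induction hypothesis requires [v \in C]; sets losing [v] have step probability 0. *)
rewrite -mulr_sumr; have [vC|vC] := boolP (v \in C); last first.
  have -> : rzf_step R e B C = 0.
    by rewrite /rzf_step ifN //; apply/subsetPn; exists v.
  by rewrite !mul0r addr0.
rewrite -[X in _ <= _ + X]mulr1 -mulrDr ler_wpM2l ?rzf_step_ge0 //.
under eq_bigr => t _ do rewrite -natr1 mulrDl mul1r.
by rewrite big_split lerD ?IH ?sum_rzf_tau_prob_le1.
Qed.

(** The terms are nonnegative, so the series converges in the extended reals, and the uniform bound
    on partial sums passes to the limit. *)
Lemma ept_rzf_le_potential v : rzf_can_color R e [set v] ->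
  (ept_rzf R e v <= (potential [set v])%:E)%E.
Proof.
move=> colv; rewrite /ept_rzf colv; apply: lime_le.
  apply: is_cvg_nneseries => n _ _.
  by rewrite lee_fin mulr_ge0 ?ler0n ?rzf_tau_prob_ge0.
apply: nearW => n; rewrite sumEFin lee_fin big_mkord.
by apply: (sum_rzf_tau_le_potential v) => //; rewrite set11.
Qed.

(** Edges are grouped by their head, the second component. *)
Lemma num_edges_sum : num_edges e = (\sum_w indegree e w)%N.
Proof.
rewrite /num_edges -sum1_card (partition_big snd xpredT) //=.
apply: eq_bigr => w _; rewrite /indegree -sum1_card.
rewrite (reindex (fun u => (u, w))) /=; last first.
  exists fst => [u _|[u x]] //; rewrite inE => /andP[_ /eqP /= ->] //.
by apply: eq_bigl => u; rewrite !inE eqxx andbT.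
Qed.

Lemma potential_set1 v :
  potential [set v] = (num_edges e)%:R - (indegree e v)%:R.
Proof.
rewrite num_edges_sum natr_sum [in RHS](bigD1 v) //= addrAC subrr add0r.
by apply: eq_bigl => w; rewrite inE.
Qed.

End ExpectedPropagationTime.

Theorem theorem4p1 (R : realType) (V : finType) (e : rel V) (d : nat) (v : V)
    (loopless : irreflexive e)
    (min_indegree : forall w : V, (d <= indegree e w)%N)
    (ept_finite : (ept_rzf R e v < +oo)%E) :
  (ept_rzf R e v <= ((num_edges e)%:R - d%:R)%:E)%E.
Proof.
(* Finiteness gives reachability, since [ept_rzf] takes the value [+oo] otherwise. *)
have colv : rzf_can_color R e [set v].
  by move: ept_finite; rewrite /ept_rzf; case: ifP.
apply: (le_trans (ept_rzf_le_potential _ _ _ _ colv)).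
by rewrite potential_set1 lee_fin lerD2l lerN2 ler_nat.
Qed.
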